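(* Let $G$ be a set with two binary operations $\cdot$ and $\triangleleft$, and let $\partial\colon C_n\to C_{n-1}$, $n\ge1$, be the associated prismatic maps. Then $\partial^2=0$ (that is, $(C_n,\partial)_{n\ge0}$ is a chain complex) if and only if $(G,\cdot,\triangleleft)$ is a shalgebra.
   Context: A shalgebra $(G,\cdot,\triangleleft)$ is a set $G$ with two binary operations such that for all $a,b,c\in G$: $(ab)c=a(bc)$; $(ab)\triangleleft c=(a\triangleleft c)(b\triangleleft c)$; $(a\triangleleft b)\triangleleft c=a\triangleleft(bc)$; $(a\triangleleft b)\triangleleft c=(a\triangleleft c)\triangleleft(b\triangleleft c)$. Here $ab$ means $a\cdot b$. Set $C_0=0$, and for $n\geq 1$ $$C_n=\bigoplus_{k_1+\cdots+k_\ell=n,\ 1\le\ell\le n,\ k_j\ge1}\mathbb{Z}[G^{k_1}\times\cdots\times G^{k_\ell}].$$ Generators are written $(g_1,\ldots,g_{k_1})|\cdots|(g_{t+1},\ldots,g_n)$. The $j$th block consists of the entries $g_{s+1},\ldots,g_{s+k_j}$, where $s=k_1+\cdots+k_{j-1}$. The map $\partial$ is given on the $j$th block by $$\partial_{j;k_j}(g_{s+1},\ldots,g_{s+k_j})=\triangleleft g_{s+1}(g_{s+2},\ldots,g_{s+k_j})+\sum_{i=1}^{k_j-1}(-1)^i(g_{s+1},\ldots,g_{s+i}\cdot g_{s+i+1},\ldots,g_{s+k_j})+(-1)^{k_j}(g_{s+1},\ldots,g_{s+k_j-1}).$$ Here the symbol $\triangleleft g_{s+1}$ means that every entry $g_t$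 of the generator to the left of the block (i.e. with $t\le s$) is replaced by $g_t\triangleleft g_{s+1}$. Blocks other than the $j$th one are otherwise unchanged, and a block that becomes empty is deleted. The map $\partial$ extends to all generators by the Leibniz rule $\partial(P|Q)=(\partial P)|Q+(-1)^pP|(\partial Q)$ for $P$ a generator of $C_p$, where the entries of $P$ are acted upon by the symbols $\triangleleft g$ coming from $\partial Q$. Explicitly, on a generator with blocks of sizes $k_1,\ldots,k_\ell$, $\partial=\sum_{j=1}^\ell(-1)^{k_1+\cdots+k_{j-1}}\partial_{j;k_j}$. On $C_1$ the map $\partial$ is zero. *)

(* Defs.v *)
From HB Require Import structures.
From mathcomp Require Import all_boot all_order all_algebra.
From mathcomp Require Import boolp.
From mathcomp.multinomials Require Import freeg.

Set Implicit Arguments.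
Unset Strict Implicit.
Unset Printing Implicit Defensive.

Import GRing.Theory.
Local Open Scope ring_scope.

Record is_shalgebra (G : Type) (mul act : G -> G -> G) : Prop := IsShalgebra {
  shalg_mulA : forall a b c, mul (mul a b) c = mul a (mul b c);
  shalg_actM : forall a b c, act (mul a b) c = mul (act a c) (act b c);
  shalg_act_act : forall a b c, act (act a b) c = act a (mul b c);
  shalg_actD : forall a b c, act (act a b) c = act (act a c) (act b c)
}.

(* (g_1, .., g_k1)|..|(g_t, .., g_n) is the list of its blocks.  Requiring at
   least one block leaves no cell when n = 0, hence C_0 = 0. *)
Definition is_cell (G : Type) (n : nat) (w : seq (seq G)) : bool :=
  [&& (0 < size w)%N, all (fun b => 0 < size b)%N w & sumn (shape w) == n].

Record cell (G : Type) (n : nat) :=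
  Cell { blocks :> seq (seq G); blocksP : is_cell n blocks }.

HB.instance Definition _ (G : Type) (n : nat) := [isSub for @blocks G n].

(* G is an arbitrary type, while {freeg _} wants a choiceType: the structure
   on cells is the classical one. *)
HB.instance Definition _ (G : Type) (n : nat) := gen_eqMixin (cell G n).
HB.instance Definition _ (G : Type) (n : nat) := gen_choiceMixin (cell G n).

(* Z[X_1] (+) .. (+) Z[X_m] is taken as the free abelian group on the disjoint
   union of the X_i, the summands being indexed by the shapes of cells. *)
Definition chain (G : Type) (n : nat) := {freeg (cell G n) / int}.

(* The words arising in the boundary of a cell of dimension n.+1 are cells of
   dimension n (faces_are_cells below), except when n = 0, where they are
   empty and stand for 0 in C_0 = 0. *)
Definition gen (G : Type) (n : nat) (w : seq (seq G)) : chain G n :=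
  if insub w is Some c then << (c : cell G n) >> else 0.

(* L|b|R, the block b being deleted if it is empty *)
Definition put_block (G : Type) (L : seq (seq G)) (b : seq G)
    (R : seq (seq G)) : seq (seq G) :=
  L ++ (if b is [::] then R else b :: R).

Section Boundary.
Variables (G : Type) (mul act : G -> G -> G).

(* (g_1, .., g_i * g_{i+1}, .., g_k), for 1 <= i < k *)
Fixpoint merge_at (i : nat) (b : seq G) : seq G :=
  match i, b with
  | 1, x :: y :: b' => mul x y :: b'
  | i'.+1, x :: b' => x :: merge_at i' b'
  | _, _ => b
  end.

Definition act_left (L : seq (seq G)) (g : G) : seq (seq G) :=
  [seq [seq act x g | x <- b] | b <- L].

(* the boundary of the middle block of L|b|R *)
Definition block_boundary (n : nat) (L : seq (seq G)) (b : seq G)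
    (R : seq (seq G)) : chain G n :=
  if b is g :: b' then
    gen n (put_block (act_left L g) b' R)
    + \sum_(1 <= i < size b) (-1) ^+ i *: gen n (put_block L (merge_at i b) R)
    + (-1) ^+ size b *: gen n (put_block L (belast g b') R)
  else 0.

(* The exponent is k_1 + .. + k_(j-1), blocks being numbered from 0 here. *)
Definition cell_boundary (n : nat) (w : seq (seq G)) : chain G n :=
  \sum_(0 <= j < size w)
    (-1) ^+ sumn (shape (take j w))
      *: block_boundary n (take j w) (nth [::] w j) (drop j.+1 w).

Definition boundary (n : nat) : chain G n.+1 -> chain G n :=
  fglift (fun c : cell G n.+1 => cell_boundary n c).

HB.instance Definition _ (n : nat) :=
  GRing.isAdditive.Build (chain G n.+1) (chain G n) (@boundary n)
    (lift_is_additive _).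

Lemma size_merge_at i b :
  (0 < i < size b)%N -> (size (merge_at i b)).+1 = size b.
Proof.
elim: i b => // i IH [|x [|y b]] //=.
by case: i IH => [//|i] IH /= lt_i; rewrite (IH (y :: b)).
Qed.

Lemma put_block_cell n (L L' R : seq (seq G)) (b b' : seq G) :
    shape L' = shape L -> (size b').+1 = size b ->
  is_cell n.+2 (L ++ b :: R) -> is_cell n.+1 (put_block L' b' R).
Proof.
have aE (A : seq (seq G)) :
    all (fun c => 0 < size c)%N A = all (ltn 0) (shape A).
  by rewrite all_map.
move=> eL sb; rewrite /is_cell /put_block !aE !/(shape _) !map_cat -!/(shape _).
rewrite eL !all_cat !sumn_cat /= -sb => /and3P[_ /and3P[aL _ aR] eqn].
have {}eqn : (sumn (shape L) + (size b' + sumn (shape R)) == n.+1)%N.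
  by move: eqn; rewrite addSn addnS eqSS.
rewrite aL /=; case: b' {sb} eqn => [|x b'] /= eqn; last first.
  by rewrite aR size_cat /= addnS eqn.
rewrite aR eqn size_cat !andbT addn_gt0.
have -> : size L' = size L by rewrite -(size_map size) -/(shape _) eL size_map.
by case: (L) eqn => [|//]; case: (R).
Qed.

(* Hence gen never discards a term of a boundary in positive dimension. *)
Lemma faces_are_cells n (L R : seq (seq G)) (g : G) (b' : seq G) :
    is_cell n.+2 (L ++ (g :: b') :: R) ->
  [/\ is_cell n.+1 (put_block (act_left L g) b' R),
      forall i, (0 < i < size (g :: b'))%N ->
        is_cell n.+1 (put_block L (merge_at i (g :: b')) R)
    & is_cell n.+1 (put_block L (belast g b') R)].
Proof.
move=> w_cell; split=> [|i /size_merge_at si|]; apply: put_block_cell w_cell => //.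
  by rewrite /shape -map_comp; apply: eq_map => b /=; rewrite size_map.
by rewrite size_belast.
Qed.

End Boundary.

(* Main.v *)
Require Import Defs.
From mathcomp Require Import all_boot all_order all_algebra.
From mathcomp.multinomials Require Import freeg.
From mathcomp Require Import boolp ring.

(** The argument is dual: instead of the chain d(w), it handles the alternating
    sum of the values f(u) over the faces u of w, for an arbitrary function f
    with values in an abelian group.  Then d(w) is the case where f sends a word
    to its generator, and d(d(w)) is the iterated sum [boundary_boundary].
    The Leibniz rule defines these sums by recursion on the word ([word_sum])
    and inside a block ([tail_sum], [block_sum]).  A face of b|R coming from R
    also acts on the entries of b, so f receives, besides the face, the map of G
    by which that face acts on everything to its left.

    For a shalgebra the iterated sum vanishes, by induction on the number of
    blocks ([word_sum_square]).  In one block, d^2 = 0 is the bar construction,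
    which needs associativity, and (x <| g) <| h = x <| (gh) for the action on
    the entries to the left ([block_sum_square]).  Faces of two different blocks
    commute because each g acts on the left by an endomorphism of both
    operations ([block_sum_act]), and lowering the dimension of the first block
    by one reverses the sign of the second, so the mixed terms cancel.

    Blocks that become empty are kept during this induction, where they
    contribute nothing, so that the number of blocks stays constant; deleting
    them afterwards does not change the sums ([word_sum_drop_empty]).

    Conversely, on the 3-cells (a,b,c), (a,b)|(c), (a)|(b,c) and (a)|(b)|(c),
    all terms of d^2 cancel except for the two sides of one shalgebra axiom
    ([shalgebra_of_square]). *)

Set Implicit Arguments.
Unset Strict Implicit.
Unset Printing Implicit Defensive.

Import GRing.Theory.
Local Open Scope ring_scope.

(** * Alternating sums over faces *)

Section FaceSums.
Variables (G : Type) (mul act : G -> G -> G).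
Implicit Types (V U : lmodType int) (b c : seq G) (w u R : seq (seq G)).

(** On an empty c the value is empty, so that it is also the face of the one-entry
    block x that deletes its last entry. *)
Definition mul_head (x : G) (c : seq G) : seq G :=
  if c is y :: d then mul x y :: d else [::].

(** The sum over the faces of b other than the zeroth, which are the ones without
    action on the left.  The faces of x :: c beyond the first are those of c
    with x put in front, and the shift of index changes the sign.  Deleting the
    last entry is the term [mul_head x [::]] at the end of the recursion. *)
Fixpoint tail_sum (V : zmodType) (f : seq G -> V) (b : seq G) : V :=
  if b is x :: c then - f (mul_head x c) - tail_sum (fun d => f (x :: d)) c
  else 0.

(** The first argument given to f is the action of the face on the entries to the
    left of the block. *)
Definition block_sum (V : zmodType) (f : (G -> G) -> seq G -> V)
    (b : seq G) : V :=
  if b is x :: c then f (act^~ x) c + tail_sum (f id) b else 0.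

(** The Leibniz rule; p is the action on b of a face of R. *)
Fixpoint word_sum (V : lmodType int) (f : (G -> G) -> seq (seq G) -> V)
    (w : seq (seq G)) : V :=
  if w is b :: R then
    block_sum (fun p c => f p (c :: R)) b
    + (-1) ^+ size b *: word_sum (fun p u => f p (map p b :: u)) R
  else 0.

Definition face_action (p : G -> G) : Prop := p = id \/ exists g, p = act^~ g.

Lemma size_mul_head x c : size (mul_head x c) = size c.
Proof. by case: c. Qed.

Lemma eq_tail_sum V (f h : seq G -> V) b :
    (forall c, (size c).+1 = size b -> f c = h c) ->
  tail_sum f b = tail_sum h b.
Proof.
elim: b f h => //= x c IH f h fh; rewrite fh ?size_mul_head //.
by congr (_ - _); apply: IH => d sd; apply: fh; rewrite /= sd.
Qed.

Lemma eq_block_sum V (f h : (G -> G) -> seq G -> V) b :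
    (forall p c, face_action p -> (size c).+1 = size b -> f p c = h p c) ->
  block_sum f b = block_sum h b.
Proof.
case: b => // x c fh; rewrite /block_sum fh //; last by right; exists x.
by congr (_ + _); apply: eq_tail_sum => d sd; apply: fh => //; left.
Qed.

(** Two functions need to agree only on words of the dimension of a face, with
    the identity or the action of one element on the left. *)
Lemma eq_word_sum V (f h : (G -> G) -> seq (seq G) -> V) w :
    (forall p u, face_action p ->
       (sumn (shape u)).+1 = sumn (shape w) -> f p u = h p u) ->
  word_sum f w = word_sum h w.
Proof.
elim: w f h => //= b R IH f h fh; congr (_ + _ *: _).
  by apply: eq_block_sum => p c ap sc; apply: fh; rewrite //= -sc.
by apply: IH => p u ap su; apply: fh; rewrite //= size_map -addnS su.
Qed.

Lemma tail_sum_raddf V U (T : {additive V -> U}) f b :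
  T (tail_sum f b) = tail_sum (fun c => T (f c)) b.
Proof.
by elim: b f => [|x c IH] f /=; rewrite ?raddf0 // raddfB raddfN IH.
Qed.

Lemma block_sum_raddf V U (T : {additive V -> U}) f b :
  T (block_sum f b) = block_sum (fun p c => T (f p c)) b.
Proof.
by case: b => [|x c]; rewrite ?raddf0 // /block_sum raddfD tail_sum_raddf.
Qed.

Lemma word_sum_raddf V U (T : {additive V -> U}) f w :
  T (word_sum f w) = word_sum (fun p u => T (f p u)) w.
Proof.
have TZ a x : T (a *: x) = a *: T x.
  by rewrite -[a]intz !scaler_int raddfMz.
elim: w f => [|b R IH] f /=; rewrite ?raddf0 //.
by rewrite raddfD TZ IH block_sum_raddf.
Qed.

Lemma tail_sumD V (f h : seq G -> V) b :
  tail_sum (fun c => f c + h c) b = tail_sum f b + tail_sum h b.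
Proof.
elim: b f h => [|x c IH] f h /=; rewrite ?addr0 // IH.
by rewrite !opprD addrACA.
Qed.

Lemma block_sumD V (f h : (G -> G) -> seq G -> V) b :
  block_sum (fun p c => f p c + h p c) b = block_sum f b + block_sum h b.
Proof.
by case: b => [|x c]; rewrite ?addr0 // /block_sum tail_sumD addrACA.
Qed.

Lemma word_sumD V (f h : (G -> G) -> seq (seq G) -> V) w :
  word_sum (fun p u => f p u + h p u) w = word_sum f w + word_sum h w.
Proof.
elim: w f h => [|b R IH] f h /=; rewrite ?addr0 //.
by rewrite IH block_sumD scalerDr addrACA.
Qed.

Lemma word_sum0 V w : word_sum (fun _ _ => 0 : V) w = 0.
Proof.
apply: (addrI (word_sum (fun _ _ => 0) w)); rewrite addr0 -word_sumD.
by apply: eq_word_sum => p u _ _; rewrite addr0.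
Qed.

(** Sums over faces of b and over faces of w can be exchanged: each is additive
    in the function summed. *)
Lemma tail_word_sum V (f : seq G -> (G -> G) -> seq (seq G) -> V) b w :
  tail_sum (fun c => word_sum (f c) w) b
  = word_sum (fun p u => tail_sum (fun c => f c p u) b) w.
Proof.
elim: b f => [|x c IH] f /=; first by rewrite word_sum0.
rewrite IH -opprD -word_sumD (word_sum_raddf -%R).
by apply: eq_word_sum => p u _ _ /=; rewrite opprD.
Qed.

Lemma block_word_sum V
    (f : (G -> G) -> seq G -> (G -> G) -> seq (seq G) -> V) b w :
  block_sum (fun q c => word_sum (f q c) w) b
  = word_sum (fun p u => block_sum (fun q c => f q c p u) b) w.
Proof.
case: b => [|x c]; first by rewrite word_sum0.
by rewrite /block_sum tail_word_sum -word_sumD.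
Qed.

(** * Vanishing of the iterated sum for a shalgebra *)

Hypothesis shG : is_shalgebra mul act.

(** Multiplying the first entry by x commutes with all these faces; for the face
    that multiplies the first two entries, this is associativity. *)
Lemma tail_sum_mul_head V (f : seq G -> V) x c :
  tail_sum f (mul_head x c) = tail_sum (fun d => f (mul_head x d)) c.
Proof.
case: c => //= y [|z c] /=; first by rewrite !subr0.
by rewrite (shalg_mulA shG).
Qed.

(** The faces of x :: c are [mul_head x c] and those of c prefixed by x.  Among
    the iterated faces, those avoiding [mul_head] vanish by induction, and the
    others appear twice with opposite signs. *)
Lemma tail_sum_square V (f : seq G -> V) b : tail_sum (tail_sum f) b = 0.
Proof.
elim: b f => //= x c IH f; rewrite tail_sumD -!(tail_sum_raddf -%R) IH.
by rewrite tail_sum_mul_head subr0 opprK addNr.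
Qed.

(** Deleting x and then y acts on the left by x and then by y, hence as xy: this
    cancels the zeroth face of the block starting with xy.  The zeroth face
    commutes with the other ones, which are dealt with by [tail_sum_square]. *)
Lemma block_sum_square V (f : (G -> G) -> seq G -> V) b :
  block_sum (fun p c => block_sum (fun q d => f (q \o p) d) c) b = 0.
Proof.
case: b => // x c.
have tail_tail : tail_sum (fun d => tail_sum (f id) (x :: d)) c
    = - tail_sum (f id) (mul_head x c).
  have /eqP := tail_sum_square (f id) (x :: c).
  by rewrite [tail_sum _ (_ :: _)]/= subr_eq0 => /eqP <-.
rewrite {1}/block_sum [tail_sum _ (_ :: _)]/= tail_sumD tail_tail opprB.
case: c {tail_tail} => [|y c]; first by rewrite /= !(subr0, oppr0, addr0).
rewrite [mul_head _ _]/= /block_sum.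
have -> : act^~ y \o act^~ x = act^~ (mul x y).
  by apply: funext => z /=; rewrite (shalg_act_act shG).
pose A := f (act^~ (mul x y)) c; pose B := tail_sum (f (act^~ x)) (y :: c).
pose C := tail_sum (f id) (mul x y :: c).
rewrite -[LHS]/(A + B + (- (A + C) + (C - B))).
by rewrite opprD -[- A - C + _]addrA addKr -opprD subrr.
Qed.

(** Naturality under an action p: p is an endomorphism of both operations, so it
    commutes with the faces inside the block, and p (z <| x) = p z <| p x
    exchanges it with the action of the zeroth face. *)
Lemma block_sum_act V (p : G -> G) (f : (G -> G) -> seq G -> V) b :
    face_action p ->
  block_sum (fun q c => f (q \o p) c) (map p b)
  = block_sum (fun q c => f (p \o q) (map p c)) b.
Proof.
move=> ap.
have pM x y : p (mul x y) = mul (p x) (p y).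
  by case: ap => [->|[g ->]] //; rewrite (shalg_actM shG).
have pact x : act^~ (p x) \o p = p \o act^~ x.
  apply: funext => z /=; case: ap => [->|[g ->]] //=.
  by rewrite [RHS](shalg_actD shG).
have pmul x c : mul_head (p x) (map p c) = map p (mul_head x c).
  by case: c => //= y c; rewrite pM.
have ptail (h : seq G -> V) c :
    tail_sum h (map p c) = tail_sum (fun d => h (map p d)) c.
  by elim: c h => //= x c IH h; rewrite pmul IH.
case: b => // x c; rewrite [map p _]/= /block_sum pact.
by rewrite -[p x :: _]/(map p (x :: c)) ptail.
Qed.

(** For w = b|R, taking two faces of b gives zero, and taking two faces of R gives
    zero by induction.  The mixed terms are compared by naturality, and their
    signs are opposite since a face of b has one entry less than b. *)
Lemma word_sum_square V (f : (G -> G) -> seq (seq G) -> V) w :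
  word_sum (fun p u => word_sum (fun q v => f (q \o p) v) u) w = 0.
Proof.
elim: w f => //= b R IH f.
rewrite block_sumD (block_sum_square (fun p c => f p (c :: R))) add0r word_sumD.
have -> : word_sum (fun p u => (-1) ^+ size (map p b) *: word_sum
      (fun q v => f (q \o p) (map q (map p b) :: v)) u) R = 0.
  rewrite -[RHS](scaler0 _ ((-1) ^+ size b)) -(IH (fun q v => f q (map q b :: v))).
  rewrite (word_sum_raddf ( *:%R _)); apply: eq_word_sum => p u _ _.
  rewrite size_map; congr (_ *: _); apply: eq_word_sum => q v _ _.
  by rewrite map_comp.
have -> : word_sum (fun p u =>
      block_sum (fun q c => f (q \o p) (c :: u)) (map p b)) R
    = block_sum (fun p c => word_sum (fun q v => f (q \o p) (map q c :: v)) R) b.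
  rewrite block_word_sum; apply: eq_word_sum => p u ap _.
  exact: (block_sum_act (fun q c => f q (c :: u))).
(* Only the mixed terms remain, now as one sum over the faces of b. *)
rewrite addr0 (block_sum_raddf ( *:%R _)) -block_sumD.
rewrite (@eq_block_sum _ _ (fun _ _ => 0)) => [|p c _ sc].
  by rewrite -(block_sum_raddf (\0%R : {additive V -> V}) (fun _ _ => 0)).
by rewrite /= -sc exprS mulN1r scaleNr subrr.
Qed.
End FaceSums.

(** * The prismatic boundary as a sum over faces *)

Section Boundary.
Variables (G : Type) (mul act : G -> G -> G).
Implicit Types (b c : seq G) (L R u w : seq (seq G)).

Local Notation bd := (@boundary G mul act _).
Local Notation cell_bd := (cell_boundary mul act).
Local Notation tail_sum := (tail_sum mul).
Local Notation block_sum := (block_sum mul act).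
Local Notation word_sum := (word_sum mul act).

Lemma tail_sumE (V : lmodType int) (f : seq G -> V) x c :
  tail_sum f (x :: c)
  = \sum_(1 <= i < size (x :: c)) (-1) ^+ i *: f (merge_at mul i (x :: c))
    + (-1) ^+ size (x :: c) *: f (belast x c).
Proof.
elim: c x f => [|y c IH] x f.
  by rewrite big_geq //= expr1 scaleN1r add0r subr0.
transitivity (- f (mul x y :: c) - tail_sum (fun d => f (x :: d)) (y :: c)).
  by [].
rewrite [in RHS]big_ltn // big_add1 [_.+1.-1]/= IH.
rewrite expr1 scaleN1r -[RHS]addrA opprD -sumrN; congr (_ + (_ + _)); last first.
  by rewrite [in RHS]exprS -scalerA scaleN1r.
rewrite !big_seq; apply: eq_bigr => -[|i]; rewrite mem_index_iota // => _.
by rewrite [in RHS]exprS -scalerA scaleN1r.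
Qed.

Lemma block_boundaryE n L b R :
  block_boundary mul act n L b R
  = block_sum (fun p c => gen n (put_block (map (map p) L) c R)) b.
Proof.
case: b => // x c; rewrite /block_boundary /block_sum tail_sumE addrA.
suff -> : [seq map id d | d <- L] = L by [].
by rewrite -[RHS]map_id; apply: eq_map => d; rewrite map_id.
Qed.

Definition drop_empty w := [seq b <- w | 0 < size b]%N.

Lemma put_block_drop_empty L c R :
    all (fun b => 0 < size b)%N L -> all (fun b => 0 < size b)%N R ->
  put_block L c R = drop_empty (L ++ c :: R).
Proof.
move=> /all_filterP nL /all_filterP nR.
by rewrite /drop_empty filter_cat /= nL nR; case: c.
Qed.

(** The boundary of a word reads its blocks together with the whole left part, so
    the induction on w carries the blocks L already passed. *)
Lemma cell_boundary_right n L w :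
    all (fun b => 0 < size b)%N (L ++ w) ->
  \sum_(0 <= j < size w) (-1) ^+ sumn (shape (L ++ take j w))
    *: block_boundary mul act n (L ++ take j w) (nth [::] w j) (drop j.+1 w)
  = (-1) ^+ sumn (shape L)
    *: word_sum (fun p u => gen n (drop_empty (map (map p) L ++ u))) w.
Proof.
elim: w L => [|b w IH] L; first by rewrite big_geq //= scaler0.
rewrite -cat_rcons => nz; rewrite big_nat_recl //= cats0 scalerDr.
under eq_bigr do rewrite -cat_rcons.
rewrite IH // /shape map_rcons sumn_rcons exprD scalerA drop0.
move: nz; rewrite all_cat all_rcons => /andP[/andP[_ nL] nw].
congr (_ *: _ + _ *: _); last first.
  by apply: eq_word_sum => p u _ _; rewrite map_rcons cat_rcons.
rewrite block_boundaryE; apply: eq_block_sum => p c _ _.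
rewrite put_block_drop_empty //.
by rewrite all_map; apply: sub_all nL => d; rewrite /= size_map.
Qed.

Lemma cell_boundaryE n w :
    all (fun b => 0 < size b)%N w ->
  cell_bd n w = word_sum (fun _ u => gen n (drop_empty u)) w.
Proof. by move/(@cell_boundary_right n [::]); rewrite scale1r. Qed.

(** An empty block has no faces, and no influence on signs or actions. *)
Lemma word_sum_drop_empty (V : lmodType int) f w :
  word_sum (fun p u => f p (drop_empty u) : V) (drop_empty w)
  = word_sum (fun p u => f p (drop_empty u)) w.
Proof.
elim: w f => [//|b w IH] f; case: (posnP (size b)) => [/size0nil-> | b_gt0].
  rewrite [drop_empty _]/= IH /= add0r scale1r.
  by apply: eq_word_sum.
have dropE p u : drop_empty (map p b :: u) = map p b :: drop_empty u.
  by rewrite /drop_empty /= size_map b_gt0.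
have -> : drop_empty (b :: w) = b :: drop_empty w by rewrite /drop_empty /= b_gt0.
rewrite [LHS]/= [RHS]/=; congr (_ + _ *: _).
  by apply: eq_block_sum => p c _ _; rewrite /drop_empty /= filter_id.
transitivity (word_sum (fun p u => f p (map p b :: drop_empty u)) w).
  rewrite -(IH (fun p v => f p (map p b :: v))).
  by apply: eq_word_sum => p u _ _; congr (f p _); exact: dropE.
by apply: eq_word_sum => p u _ _ /=; rewrite size_map b_gt0.
Qed.

Lemma genE n w (w_cell : is_cell n w) : gen n w = << Cell w_cell >>.
Proof. by rewrite /gen insubT. Qed.

Lemma boundary_gen n w :
  is_cell n.+1 w -> bd (gen n.+1 w) = cell_bd n w.
Proof. by move=> w_cell; rewrite (genE w_cell) /boundary liftU scale1r. Qed.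

(** A word of positive dimension keeps at least one block. *)
Lemma is_cell_drop_empty n w :
  is_cell n.+1 (drop_empty w) = (sumn (shape w) == n.+1).
Proof.
rewrite /is_cell filter_all /=.
have -> : sumn (shape (drop_empty w)) = sumn (shape w).
  by elim: w => //= -[|x b] w IH; rewrite /= IH.
case: eqP => sw; rewrite ?andbF // andbT.
by elim: w sw => //= -[|x b] w IH.
Qed.

(** The faces of w have dimension n.+1 > 0, hence are cells once their empty
    blocks are deleted, so that [gen] discards none of them. *)
Lemma boundary_boundary n w :
    is_cell n.+2 w ->
  bd (bd (gen n.+2 w))
  = word_sum (fun _ u => word_sum (fun _ v => gen n (drop_empty v)) u) w.
Proof.
move=> w_cell; have /and3P[_ nz_w /eqP sw] := w_cell.
rewrite boundary_gen // cell_boundaryE // (word_sum_raddf _ _ bd).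
apply: eq_word_sum => p u _ /eqP; rewrite sw eqSS -is_cell_drop_empty => u_cell.
rewrite /= boundary_gen // cell_boundaryE ?filter_all //.
exact: (word_sum_drop_empty (fun _ v => gen n v)).
Qed.

Lemma boundary_boundary_eq0 n :
  (forall w, is_cell n.+2 w -> bd (bd (gen n.+2 w)) = 0) ->
  forall x : chain G n.+2, bd (bd x) = 0.
Proof.
move=> bdbd x; rewrite -(freeg_sumE x) 2!raddf_sum big1 // => -[w w_cell] _.
by rewrite -[coeff _ x]intz -freegU_mulz 2!raddfMz -genE /= bdbd // mul0rz.
Qed.

(** * The axioms from low dimension *)

Lemma gen1_inj : injective (fun x : G => gen 1 [:: [:: x]]).
Proof.
move=> x y; have one_cell (z : G) : is_cell 1 [:: [:: z]] by [].
rewrite !(genE (one_cell _)) => /(congr1 (coeff (Cell (one_cell x)))).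
rewrite !coeffU eqxx !mul1r; case: eqP => // -[] //.
Qed.

(** Taking coefficients replaces chains by integer-valued functions h, for which
    the cancellations in d^2 become identities in the ring of integers. *)
Lemma eq_of_square x y w :
    is_cell 3 w -> bd (bd (gen 3 w)) = 0 ->
    (forall h : seq (seq G) -> int^o,
       word_sum (fun _ u => word_sum (fun _ v => h (drop_empty v)) u) w
       = h [:: [:: x]] - h [:: [:: y]]) ->
  x = y.
Proof.
move=> w_cell; rewrite boundary_boundary // => sq0 hw.
apply: gen1_inj; apply/eqP/freeg_eqP => c.
pose T : {additive chain G 1 -> int^o} := coeff c.
have : T (word_sum (fun _ u => word_sum (fun _ v => gen 1 (drop_empty v)) u) w)
    = T (gen 1 [:: [:: x]]) - T (gen 1 [:: [:: y]]).
  rewrite -(hw (fun v => T (gen 1 v))) word_sum_raddf.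
  by apply: eq_word_sum => p u _ _; rewrite word_sum_raddf.
by rewrite sq0 raddf0 => /esym/eqP; rewrite subr_eq0 => /eqP.
Qed.

Lemma shalgebra_of_square :
    (forall w, is_cell 3 w -> bd (bd (gen 3 w)) = 0) ->
  is_shalgebra mul act.
Proof.
pose simp := (scaler0, expr1, exprS, expr0, mulr1, mulN1r, opprK,
              scaleN1r, scale1r, subr0, addr0).
move=> sq0; split=> a b c.
- apply: (@eq_of_square _ _ [:: [:: a; b; c]]) => [//||h]; first exact: sq0.
  by rewrite /= !simp; ring.
- apply: (@eq_of_square _ _ [:: [:: a; b]; [:: c]]) => [//||h]; first exact: sq0.
  by rewrite /= !simp; ring.
- apply: (@eq_of_square _ _ [:: [:: a]; [:: b; c]]) => [//||h]; first exact: sq0.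
  by rewrite /= !simp; ring.
- apply: (@eq_of_square _ _ [:: [:: a]; [:: b]; [:: c]]) => [//||h]; first exact: sq0.
  by rewrite /= !simp; ring.
Qed.
End Boundary.

Theorem mainTheorem3 (G : Type) (mul act : G -> G -> G) :
  (forall (n : nat) (x : chain G n.+2),
     boundary mul act (boundary mul act x) = 0%R)
  <-> is_shalgebra mul act.
Proof.
split=> [sq0 | shG n]; first by apply: shalgebra_of_square => w _; apply: sq0.
move=> x; apply: (@boundary_boundary_eq0 _ mul act n) => w /(boundary_boundary _) ->.
exact: (word_sum_square shG (fun _ v => gen n (drop_empty v))).
Qed.
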